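(* Let $d\ge 1$, let $M\in\mathbb{R}^{d\times d}$ satisfy $M+M^\top\succeq 0$, and let $q\in\mathbb{R}^d$. Let $\mathcal{F}$ be the (single-valued) operator with domain $\mathbb{R}^d\times\mathbb{R}_{++}$ given by $$\mathcal{F}(z,\tau)=\begin{bmatrix} Mz+q\tau\\ -z^\top Mz/\tau - z^\top q\end{bmatrix},$$ and let $\mathcal{I}$ be the set-valued operator on $\mathbb{R}^{d+1}$ with domain $\{(z,0)\mid z\in\mathbb{R}^d,\ z^\top Mz=0\}$ given there by $$\mathcal{I}(z,0)=\left\{\begin{bmatrix} Mz\\ \kappa\end{bmatrix}\ \middle|\ \kappa\in\mathbb{R},\ \kappa\le -z^\top q\right\}.$$ Then the operator $\mathcal{Q}=\mathcal{F}\cup\mathcal{I}$ on $\mathbb{R}^{d+1}$ (union of graphs) is maximal monotone.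
   Context: An operator on $\mathbb{R}^p$ is identified with its graph, a subset of $\mathbb{R}^p\times\mathbb{R}^p$; for an operator $T$, $T(x)=\{y\mid (x,y)\in T\}$ and the domain of $T$ is $\{x\mid T(x)\ne\emptyset\}$. $T$ is monotone if $(u-v)^\top(x-y)\ge 0$ for all $(x,u),(y,v)\in T$. A monotone operator is maximal if its graph is not strictly contained in the graph of another monotone operator on $\mathbb{R}^p$. $\mathbb{R}_{++}$ denotes the strictly positive reals, and $M+M^\top\succeq 0$ means that $M+M^\top$ is positive semidefinite. *)

(* Defs.v *)
From HB Require Import structures.
From mathcomp Require Import all_boot all_order all_algebra.
From mathcomp Require Import boolp classical_sets reals.

Set Implicit Arguments.
Unset Strict Implicit.
Unset Printing Implicit Defensive.

Import Order.TTheory GRing.Theory Num.Theory.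

Local Open Scope classical_set_scope.
Local Open Scope ring_scope.

Section Operators.
Variable R : realType.

Definition dotv (n : nat) (x y : 'cV[R]_n) : R := (x^T *m y) 0 0.

Definition psdmx (n : nat) (A : 'M[R]_n) : Prop :=
  A^T = A /\ forall x : 'cV[R]_n, 0 <= dotv x (A *m x).

(* An operator is identified with its graph. *)
Definition operator (p : nat) : Type := set ('cV[R]_p * 'cV[R]_p).

Definition monotone (p : nat) (T : operator p) : Prop :=
  forall x u y v : 'cV[R]_p, T (x, u) -> T (y, v) -> 0 <= dotv (u - v) (x - y).

Definition maximal_monotone (p : nat) (T : operator p) : Prop :=
  monotone T /\ ~ exists S : operator p, monotone S /\ T `<` S.

Section HomogeneousEmbedding.
Variables (d : nat) (M : 'M[R]_d) (q : 'cV[R]_d).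

Definition vpair (z : 'cV[R]_d) (t : R) : 'cV[R]_(d + 1) := col_mx z t%:M.

Definition opF : operator (d + 1) :=
  [set xy | exists (z : 'cV[R]_d) (tau : R),
     0 < tau /\
     xy = (vpair z tau,
           vpair (M *m z + tau *: q)
                 (- (dotv z (M *m z) / tau) - dotv z q))].

Definition opI : operator (d + 1) :=
  [set xy | exists (z : 'cV[R]_d) (kappa : R),
     [/\ dotv z (M *m z) = 0,
         kappa <= - dotv z q
       & xy = (vpair z 0, vpair (M *m z) kappa)]].

Definition opQ : operator (d + 1) := opF `|` opI.

End HomogeneousEmbedding.
End Operators.

(* Main.v *)
(** Monotonicity of [opQ] on its finite part rests on the identity
    [<F(z,t) - F(w,s), (z,t) - (w,s)> = t s <z/t - w/s, M (z/t - w/s)>], and on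
    its part at [tau = 0] on the fact that [<z, M z> = 0] forces [(M + M^T) z = 0].
    Maximality is the easy half of Minty's theorem: it is enough that [I + opQ]
    is surjective. For a target [(r, s)] the first block gives
    [z = (I + M)^-1 (r - tau q)], and the second becomes a quadratic equation in
    [tau] with positive leading coefficient and nonpositive constant term; it
    either has a positive root, or its data give a solution with [tau = 0]. *)
Require Import Defs.
From mathcomp Require Import all_boot all_order all_algebra.
From mathcomp Require Import classical_sets reals.
From mathcomp Require Import ring lra.

Import Order.TTheory GRing.Theory Num.Theory.

Local Open Scope ring_scope.

Section Dotv.
Variables (R : realType) (n : nat).
Implicit Types (x y z : 'cV[R]_n) (a : R) (M : 'M[R]_n).

Lemma dotvC x y : dotv x y = dotv y x.
Proof. by rewrite /dotv -[in LHS](trmxK y) -trmx_mul mxE. Qed.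

Lemma dotvDl x y z : dotv (x + y) z = dotv x z + dotv y z.
Proof. by rewrite /dotv linearD mulmxDl mxE. Qed.

Lemma dotvZl a x y : dotv (a *: x) y = a * dotv x y.
Proof. by rewrite /dotv linearZ -scalemxAl mxE. Qed.

Lemma dotvNl x y : dotv (- x) y = - dotv x y.
Proof. by rewrite -scaleN1r dotvZl mulN1r. Qed.

Lemma dotvDr x y z : dotv z (x + y) = dotv z x + dotv z y.
Proof. by rewrite !(dotvC z) dotvDl. Qed.

Lemma dotvZr a x y : dotv y (a *: x) = a * dotv y x.
Proof. by rewrite !(dotvC y) dotvZl. Qed.

Lemma dotvNr x y : dotv y (- x) = - dotv y x.
Proof. by rewrite !(dotvC y) dotvNl. Qed.

Lemma dotv_trmx M x y : dotv x (M^T *m y) = dotv y (M *m x).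
Proof. by rewrite dotvC /dotv trmx_mul trmxK mulmxA. Qed.

Lemma dotvv_sum x : dotv x x = \sum_i x i 0 ^+ 2.
Proof. by rewrite /dotv mxE; apply: eq_bigr => i _; rewrite mxE expr2. Qed.

Lemma dotvv_ge0 x : 0 <= dotv x x.
Proof. by rewrite dotvv_sum sumr_ge0 // => i _; rewrite sqr_ge0. Qed.

Lemma dotvv_le0 x : dotv x x <= 0 -> x = 0.
Proof.
move=> x_le0; have /eqP : dotv x x = 0 by apply/le_anti; rewrite x_le0 dotvv_ge0.
rewrite dotvv_sum psumr_eq0 => [/allP x0|i _]; last exact: sqr_ge0.
apply/colP => i; rewrite mxE; apply/eqP.
by have := x0 i (mem_index_enum i); rewrite sqrf_eq0.
Qed.

End Dotv.

Definition dotvE := (dotvDl, dotvDr, dotvNl, dotvNr, dotvZl, dotvZr).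
Definition mulmx_colE := (mulmxDr, mulmxN, =^~ scalemxAr).

Section Vpair.
Variables (R : realType) (d : nat).
Implicit Types (z w : 'cV[R]_d) (t s : R).

Lemma dotv_vpair z w t s : dotv (vpair z t) (vpair w s) = dotv z w + t * s.
Proof.
rewrite /dotv /vpair tr_col_mx mul_row_col mxE; congr (_ + _).
by rewrite tr_scalar_mx mul_scalar_mx !mxE !mulr1n.
Qed.

Lemma vpairD z w t s : vpair z t + vpair w s = vpair (z + w) (t + s).
Proof. by rewrite /vpair add_col_mx raddfD. Qed.

Lemma vpairB z w t s : vpair z t - vpair w s = vpair (z - w) (t - s).
Proof. by rewrite /vpair opp_col_mx add_col_mx raddfB. Qed.

Lemma vpairP (x : 'cV[R]_(d + 1)) : exists z t, x = vpair z t.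
Proof.
exists (usubmx x), (dsubmx x 0 0).
by rewrite /vpair -[x in LHS]vsubmxK [dsubmx x in LHS]mx11_scalar.
Qed.

End Vpair.

Section PsdForm.
Variables (R : realType) (d : nat) (M : 'M[R]_d).
Hypothesis M_psd : psdmx (M + M^T).
Implicit Types z w : 'cV[R]_d.

Lemma psd_form_ge0 z : 0 <= dotv z (M *m z).
Proof.
by case: M_psd => _ /(_ z); rewrite mulmxDl dotvDr dotv_trmx; lra.
Qed.

(** The form is nonnegative, so an isotropic [z] minimizes it and its derivative at [z] along [w]
    vanishes. Were that derivative [c] nonzero, the step [t] below would give the form the value
    -1. *)
Lemma psd_form_isotropic z w :
  dotv z (M *m z) = 0 -> dotv z (M *m w) + dotv w (M *m z) = 0.
Proof.
move=> zMz0; apply/eqP/negPn/negP; set c := _ + _ => c_neq0.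
(* [w + t z] has form value [<w, M w> + t c], which is affine in [t]. *)
have := psd_form_ge0 (w + (- (dotv w (M *m w) + 1) / c) *: z).
set t := _ / c; have tc : t * c = - (dotv w (M *m w) + 1) by rewrite /t mulfVK.
rewrite !mulmx_colE !dotvE zMz0; move: tc; rewrite /c; nra.
Qed.

Lemma psd_form_unitmx : 1%:M + M \in unitmx.
Proof.
(* [v] is a row in the left kernel; multiplying by [v^T] gives [<v, v> + <v, M v> = 0], where both
   terms are nonnegative. *)
rewrite unitmxE unitfE; apply/negP => /det0P [v v_neq0 vM].
case/eqP: v_neq0; apply: trmx_inj; rewrite trmx0; apply: dotvv_le0.
have := psd_form_ge0 v^T.
have : dotv v^T ((1%:M + M) *m v^T) = 0.
  by rewrite /dotv trmxK mulmxA vM mul0mx mxE.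
by rewrite mulmxDl mul1mx dotvDr; lra.
Qed.

End PsdForm.

(** The larger root is positive unless the root [s] of the discriminant is at most [B]; then
    [s ^+ 2 <= B ^+ 2] forces [A * C >= 0], hence [C = 0]. *)
Lemma quadratic_pos_root (R : rcfType) (A B C : R) : 0 < A -> C <= 0 ->
  (exists2 t, 0 < t & A * t ^+ 2 + B * t + C = 0) \/ (C = 0 /\ 0 <= B).
Proof.
move=> A_gt0 C_le0; have A_neq0 : A != 0 by rewrite gt_eqF.
have D_ge0 : 0 <= B ^+ 2 - 4 * A * C by nra.
have sD := sqr_sqrtr D_ge0; have s_ge0 := sqrtr_ge0 (B ^+ 2 - 4 * A * C).
set s := Num.sqrt _ in sD s_ge0.
have [sB|Bs] := ltP B s.
  left; exists ((s - B) / (2 * A)); first by apply: divr_gt0; lra.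
  have -> : A * ((s - B) / (2 * A)) ^+ 2 + B * ((s - B) / (2 * A)) + C
          = (s ^+ 2 - (B ^+ 2 - 4 * A * C)) / (4 * A) by field.
  by rewrite sD subrr mul0r.
have B_ge0 : 0 <= B by lra.
right; split=> //; apply/le_anti; rewrite C_le0 /=.
have : A * C >= 0 by nra.
by rewrite pmulr_rge0.
Qed.

Section HomogeneousEmbedding.
Variables (R : realType) (d : nat) (M : 'M[R]_d) (q : 'cV[R]_d).
Hypothesis M_psd : psdmx (M + M^T).

Lemma opF_monotone : monotone (opF M q).
Proof.
move=> _ _ _ _ [z [t [t_gt0 [-> ->]]]] [w [s [s_gt0 [-> ->]]]].
have t_neq0 : t != 0 by rewrite gt_eqF.
have s_neq0 : s != 0 by rewrite gt_eqF.
have := psd_form_ge0 _ _ _ M_psd (t^-1 *: z - s^-1 *: w).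
rewrite -(pmulr_rge0 _ (mulr_gt0 t_gt0 s_gt0)); congr (0 <= _).
rewrite !vpairB dotv_vpair !mulmx_colE !dotvE.
(* Moving [M *m _] and [q] to the second slot makes equal inner products the same atom for
   [field]. *)
rewrite !(dotvC _ _ (M *m _)) !(dotvC _ _ q).
by field; apply/andP.
Qed.

(** The mixed terms in [M] cancel by isotropy of [z], and [<w, M w>] and [s <w, q>] cancel between
    the blocks. What remains is [s (- <z, q> - k)]. *)
Lemma opF_opI_monotone (x u y v : 'cV[R]_(d + 1)) :
  opF M q (x, u) -> opI M q (y, v) -> 0 <= dotv (u - v) (x - y).
Proof.
move=> [w [s [s_gt0 [-> ->]]]] [z [k [zMz0 k_le [-> ->]]]].
have zw := psd_form_isotropic _ _ _ M_psd z w zMz0.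
rewrite !vpairB dotv_vpair !dotvE !(dotvC _ _ (M *m _)) !(dotvC _ _ q) zMz0.
rewrite subr0.
have -> : (- (dotv w (M *m w) / s) - dotv w q - k) * s
        = - dotv w (M *m w) - dotv w q * s - k * s.
  by field; rewrite gt_eqF.
nra.
Qed.

Lemma opI_monotone : monotone (opI M q).
Proof.
move=> _ _ _ _ [z [k [_ _ [-> ->]]]] [w [l [_ _ [-> ->]]]].
rewrite !vpairB dotv_vpair subrr mulr0 addr0 -mulmxBr dotvC.
exact: psd_form_ge0.
Qed.

Lemma opQ_monotone : monotone (opQ M q).
Proof.
move=> x u y v [Fx|Ix] [Fy|Iy].
- exact: opF_monotone Fx Fy.
- exact: opF_opI_monotone.
- have -> : dotv (u - v) (x - y) = dotv (v - u) (y - x).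
    by rewrite -(opprB v) -(opprB y) dotvNl dotvNr opprK.
  exact: opF_opI_monotone.
- exact: opI_monotone Ix Iy.
Qed.

Lemma opQ_resolvent_total (e : 'cV[R]_(d + 1)) :
  exists x u, opQ M q (x, u) /\ x + u = e.
Proof.
have [r [s ->]] := vpairP _ _ e.
have M1_unit := psd_form_unitmx _ _ _ M_psd.
(* The first block is solved by [z = a - t b]. *)
pose a := invmx (1%:M + M) *m r; pose b := invmx (1%:M + M) *m q.
have rE : r = a + M *m a by rewrite -{1}[a]mul1mx -mulmxDl mulKVmx.
have qE : q = b + M *m b by rewrite -{1}[b]mul1mx -mulmxDl mulKVmx.
have aMa_ge0 := psd_form_ge0 _ _ _ M_psd a.
(* These coefficients come from putting [z = a - t b] and [q = b + M b] into the second block and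
   multiplying by [t]; the terms [<b, M b>] and [<a, M b>] cancel. *)
have [||[t t_gt0 tE]|[aMa0 B_ge0]] := @quadratic_pos_root R
  (1 + dotv b b) (dotv b (M *m a) - dotv a b - s) (- dotv a (M *m a)).
- by have := dotvv_ge0 _ _ b; lra.
- lra.
- pose z := a - t *: b.
  exists (vpair z t),
    (vpair (M *m z + t *: q) (- (dotv z (M *m z) / t) - dotv z q)).
  split; first by left; exists z, t.
  have zE : z + M *m z = r - t *: q.
    by rewrite rE qE mulmxBr -scalemxAr scalerDr opprD addrACA.
  rewrite vpairD addrA zE subrK; congr vpair.
  have -> : t + (- (dotv z (M *m z) / t) - dotv z q)
          = (t ^+ 2 - dotv z (M *m z) - dotv z q * t) / t.
    by field; rewrite gt_eqF.
  apply/(canLR (mulfK _)); first by rewrite gt_eqF.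
  rewrite /z qE !mulmx_colE !dotvE; lra.
- exists (vpair a 0), (vpair (M *m a) s); split; last by rewrite vpairD add0r -rE.
  right; exists a, s; split=> //; first by lra.
  (* Isotropy of [a] turns [<b, M a>] into [- <a, M b>], so the sign of the linear coefficient reads
     [s <= - <a, q>]. *)
  have := psd_form_isotropic _ _ _ M_psd a b; rewrite qE dotvDr; lra.
Qed.

(** For [(x, u)] in [S], choose [(y, v)] in [opQ M q] with the same sum. Then [u - v = - (x - y)],
    and monotonicity of [S] gives [- <x - y, x - y> >= 0], so the two pairs coincide. *)
Lemma opQ_maximal (S : operator R (d + 1)) :
  monotone S -> (opQ M q `<=` S)%classic -> (S `<=` opQ M q)%classic.
Proof.
move=> S_mono QS [x u] Sxu.
have [y [v [Qyv yvE]]] := opQ_resolvent_total (x + u).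
have uvE : u - v = - (x - y).
  by rewrite opprB; apply/eqP; rewrite subr_eq addrAC eq_sym subr_eq yvE addrC.
have := S_mono _ _ _ _ Sxu (QS _ Qyv).
rewrite uvE dotvNl oppr_ge0 => /dotvv_le0 /eqP xy.
move: uvE; rewrite (eqP xy) oppr0 => /eqP; rewrite subr_eq0 => /eqP ->.
by move: xy; rewrite subr_eq0 => /eqP ->.
Qed.

End HomogeneousEmbedding.

Theorem lemma4p4 (R : realType) (d : nat) (hd : (1 <= d)%N)
    (M : 'M[R]_d) (q : 'cV[R]_d) (hM : psdmx (M + M^T)) :
  maximal_monotone (opQ M q).
Proof.
split; first exact: opQ_monotone.
by move=> [S [S_mono [QS]]]; apply; apply: opQ_maximal.
Qed.
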